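(* Fix a time $t$, a state $s_t$, and a factorized categorical policy $\pi_t=\prod_{i\in\mathcal N_t}\pi^i$. Let the actions $a_{i,t}\sim\pi^i(\cdot\mid o_{i,t})$, $i\in\mathcal N_t$, be sampled independently, let $A_t=\{(i,a_{i,t}):i\in\mathcal N_t\}$ and $A_t^{-i}=A_t\setminus\{(i,a_{i,t})\}$, and define the marginal-gain estimator $$\widehat g_{i,a,t}=F_t(A_t^{-i}\cup\{(i,a)\};s_t)-F_t(A_t^{-i};s_t),\qquad i\in\mathcal N_t,\ a\in\mathcal A_i.$$ Then, for every $(i,a)\in\Omega_t$, $$\mathbb E\big[\widehat g_{i,a,t}\mid\pi_t,s_t\big]=\frac{\partial\tilde f_t}{\partial x_{(i,a)}}\big(x_t^\pi(s_t);s_t\big),$$ where $x_t^\pi(s_t)\in[0,1]^{\Omega_t}$ has coordinates $x^\pi_{(i,a),t}(s_t)=\pi^i(a\mid o_{i,t})$; i.e. $\widehat g_{i,\cdot,t}$ is an unbiased estimator of the local gradient of the partition multilinear extension $\tilde f_t(\cdot;s_t)$ at the current policy.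
   Context: $\mathcal N_t$ is a finite set of active agents; each agent $i$ has a finite nonempty action set $\mathcal A_i$ and a finite observation space $\mathcal O_i$; $o_{i,t}=O_{i,t}(s_t)\in\mathcal O_i$ is a deterministic function of the state $s_t$. A local policy $\pi^i$ assigns to each $o\in\mathcal O_i$ a probability distribution $\pi^i(\cdot\mid o)$ on $\mathcal A_i$. $\Omega_t=\{(i,a):i\in\mathcal N_t,\ a\in\mathcal A_i\}$, $\Omega_{i,t}=\{(i,a):a\in\mathcal A_i\}$, $\mathcal I_t=\{A\subseteq\Omega_t:|A\cap\Omega_{i,t}|\le1\ \forall i\in\mathcal N_t\}$. $F_t(\cdot;s_t):2^{\Omega_t}\to\mathbb R_{\ge0}$ is the stage utility, assumed normalized ($F_t(\emptyset;s_t)=0$), monotone and submodular. Partition multilinear extension: $$\tilde f_t(x;s_t)=\sum_{A\in\mathcal I_t}F_t(A;s_t)\prod_{i\in\mathcal N_t}p_i(A;x),$$ where $p_i(A;x)=x_{(i,a)}$ if $A\cap\Omega_{i,t}=\{(i,a)\}$ and $p_i(A;x)=1-\sum_{a'\in\mathcal A_i}x_{(i,a')}$ if $A\cap\Omega_{i,t}=\emptyset$. It is defined for $x\in[0,1]^{\Omega_t}$ with $\sum_{a\in\mathcal A_i}x_{(i,a)}\le1$ for all $i\in\mathcal N_t$; partial derivatives are those of the polynomial given by this formula. *)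

(* Defs.v *)
From HB Require Import structures.
From mathcomp Require Import all_boot all_order all_algebra.
From mathcomp Require Import finmap.
From mathcomp Require Import all_classical all_reals all_analysis.
Set Implicit Arguments.
Unset Strict Implicit.
Unset Printing Implicit Defensive.
Import Order.TTheory GRing.Theory Num.Theory.
Import numFieldNormedType.Exports.
Local Open Scope ring_scope.

Section SetFunctions.
Context {R : realType} {E : finType}.
Implicit Types F : {set E} -> R.

Definition set_fun_nonneg F := forall S, 0 <= F S.

Definition set_fun_normalized F := F finset.set0 = 0.

Definition set_fun_monotone F :=
  forall S S' : {set E}, S \subset S' -> F S <= F S'.

Definition set_fun_submodular F :=
  forall S S' : {set E}, F (S :|: S') + F (S :&: S') <= F S + F S'.

End SetFunctions.

(* A probability distribution on a finite set, given by its mass function. *)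
Definition is_pmf {R : realType} {X : finType} (p : X -> R) :=
  (forall a, 0 <= p a) /\ \sum_a p a = 1.

Section PartitionExtension.
Context {R : realType} {I : finType} (A : I -> finType).

(* The pairs (i, a) with i in I and a in A i; the pair (i, a) is
   [Tagged A a]. *)
Definition ground : finType := {i : I & A i}.

Definition block (i : I) : {set ground} := [set e : ground | tag e == i]%SET.

Definition part_indep (S : {set ground}) : bool :=
  [forall i, #|S :&: block i| <= 1]%N.

(* The factor p_i(S; x). For S in the partition matroid, S :&: block i is
   either a singleton or empty, so that the case [None] is the empty case. *)
Definition part_factor (i : I) (S : {set ground}) (x : ground -> R) : R :=
  if [pick a : A i | S :&: block i == [set Tagged A a]%SET] is Some a
  then x (Tagged A a)
  else 1 - \sum_(a : A i) x (Tagged A a).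

(* The formula is taken on all of R^ground, and not only on the polytope of
   the x with nonnegative coordinates and block sums at most 1: policies lie
   on the boundary of the polytope, and partial derivatives there are those
   of the polynomial. *)
Definition part_multilinear (F : {set ground} -> R) (x : ground -> R) : R :=
  \sum_(S : {set ground} | part_indep S) F S * \prod_(i : I) part_factor i S x.

Definition set_coord (x : ground -> R) (e : ground) (u : R) : ground -> R :=
  fun e' => if e' == e then u else x e'.

Definition partial_derivative (f : (ground -> R) -> R) (e : ground)
    (x : ground -> R) : R :=
  (fun u : R => f (set_coord x e u))^`()%classic (x e).

(* [derive1] is total; on the multilinear extension it is a genuine
   derivative. *)
Lemma derivable_part_multilinear (F : {set ground} -> R) e x (u : R) :
  derivable (fun v : R => part_multilinear F (set_coord x e v)) u 1.
Proof.
have dc e' : derivable (fun v : R => set_coord x e v e') u 1.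
  rewrite /set_coord; case: (e' == e); first exact: derivable_id.
  exact: derivable_cst.
have dsum (J : Type) (r : seq J) (Q : pred J) (g : J -> R -> R) :
    (forall j, derivable (g j) u 1) ->
  derivable (fun v => \sum_(j <- r | Q j) g j v) u 1.
  move=> dg; elim: r => [|j r IHr].
    under eq_fun do rewrite big_nil.
    exact: derivable_cst.
  under eq_fun do rewrite big_cons.
  by case: (Q j) => //; exact: derivableD.
have dprod (J : Type) (r : seq J) (g : J -> R -> R) :
    (forall j, derivable (g j) u 1) ->
  derivable (fun v => \prod_(j <- r) g j v) u 1.
  move=> dg; elim: r => [|j r IHr].
    under eq_fun do rewrite big_nil.
    exact: derivable_cst.
  under eq_fun do rewrite big_cons.
  exact: derivableM.
apply: (dsum) => S; apply: derivableM; first exact: derivable_cst.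
apply: dprod => i; rewrite /part_factor; case: pickP => [a _|_].
  exact: dc.
apply: derivableB; first exact: derivable_cst.
by apply: dsum => a; exact: dc.
Qed.

(* The set {(i, a i) : i in I} of an action profile. *)
Definition profile_set (a : forall i, A i) : {set ground} :=
  [set Tagged A (a i) | i in I]%SET.

Definition marginal_gain (F : {set ground} -> R) (a : forall i, A i)
    (i : I) (b : A i) : R :=
  let S := (profile_set a :\ Tagged A (a i))%SET in
  F (S :|: [set Tagged A b]%SET)%SET - F S.

Section RandomActions.
Context {d : measure_display} {T : measurableType d} (P : probability T R).
Variable act : forall i, T -> A i.

(* Measurability for the discrete sigma-algebras on the finite sets A i. *)
Definition actions_measurable :=
  forall i (B : set (A i)), measurable (act i @^-1` B)%classic.

Definition actions_law (p : forall i, A i -> R) :=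
  forall i (a : A i), P (act i @^-1` [set a])%classic = (p i a)%:E.

(* Mutual independence; the product rule for subfamilies is the case where
   some of the B i are full. *)
Definition actions_independent :=
  forall B : forall i, set (A i),
    P (\bigcap_i (act i @^-1` B i))%classic
    = (\prod_(i : I) P (act i @^-1` B i)%classic)%E.

End RandomActions.

End PartitionExtension.

Arguments marginal_gain {R I A} F a i b.

(* The action sets of the active agents Nt, as a family over the finite type
   of members of Nt; its [ground] is the ground set Omega_t. *)
Definition active {Agent : choiceType} (Act : Agent -> finType)
    (Nt : {fset Agent}) : Nt -> finType := fun i => Act (val i).
Arguments active {Agent} Act Nt _ /.

(* Main.v *)
(* An independent set picks at most one element in each block, so the partition
   multilinear extension is a sum over families of choices q i : option (A i),
   with weight the product over i of x_(i, b) if q i = b and of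
   1 - sum_b x_(i, b) if q i = None. It is therefore affine in x_(i, a), and
   x_(i, a) enters the weight with slope 1 at q i = a and -1 at q i = None: the
   partial derivative is the sum, over the choices in the other blocks, of their
   weight times the marginal gain of (i, a). The weights in block i sum to 1, so
   one may also sum over the (ignored) choice in block i. At a policy the choice
   None has weight 0 and the weights are the law of the sampled profile. *)

Require Import Defs.
From HB Require Import structures.
From mathcomp Require Import all_boot all_order all_algebra.
From mathcomp Require Import finmap.
From mathcomp Require Import all_classical all_reals all_analysis.
From mathcomp Require Import ring.
Import Order.TTheory GRing.Theory Num.Theory.
Local Open Scope ring_scope.

Set Implicit Arguments.
Unset Strict Implicit.

(** [g \o Y] is a finite combination of indicators of the fibres of [Y], integrated term by term.
    Measurability is asked of fibres because [X] carries no sigma-algebra. *)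
Lemma expectation_fin (d : measure_display) (T : measurableType d)
    (R : realType) (P : probability T R) (X : finType) (Y : T -> X)
    (g : X -> R) :
  (forall x, measurable (Y @^-1` [set x])%classic) ->
  ('E_P[g \o Y])%E = \sum_x ((g x)%:E * P (Y @^-1` [set x])%classic)%E.
Proof.
move=> mY; rewrite unlock.
have intg x : P.-integrable setT
    (fun w => ((g x)%:E * (\1_(Y @^-1` [set x]) w)%:E)%E).
  by apply: integrableZl => //; exact: integrable_indic.
transitivity (\int[P]_w
    \sum_x ((g x)%:E * (\1_(Y @^-1` [set x])%classic w)%:E)%E)%E.
  apply: eq_integral => w _.
  rewrite (bigD1 (Y w))//= big1 => [|x xY].
    by rewrite adde0 indicE mem_set// mule1.
  by rewrite indicE memNset ?mule0//= => wx; rewrite wx eqxx in xY.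
rewrite integral_sum//; apply: eq_bigr => x _.
rewrite integralZl//; last exact: integrable_indic.
by rewrite integral_indic// setIT.
Qed.

(** * Independent sets as families of choices *)

Section OptionProfiles.
Context {R : realType} {I : finType} (A : I -> finType).

(* A set with at most one element in each block, encoded by the choice
   ([None] when the block is avoided) that it makes in each block. *)
Local Notation choices := {dffun forall i, option (A i)}.

Definition choice_set (q : choices) : {set ground A} :=
  [set e : ground A | q (tag e) == Some (tagged e)]%SET.

Definition set_choice (S : {set ground A}) : choices :=
  [ffun i => [pick a : A i | Tagged A a \in S]].

(** On the associated sets, [None] deletes the element in block [i], and [Some a] puts [a] in its
    place. *)
Definition with_choice (q : choices) (i : I) (b : option (A i)) : choices :=
  finfun (eqtype.dfwith q b).

Definition choice_weight (x : ground A -> R) (i : I) (b : option (A i)) : R :=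
  if b is Some a then x (Tagged A a) else 1 - \sum_(a : A i) x (Tagged A a).

Lemma mem_choice_set q i (a : A i) :
  (Tagged A a \in choice_set q) = (q i == Some a).
Proof. by rewrite inE. Qed.

Lemma with_choice_in q i (b : option (A i)) : with_choice q b i = b.
Proof. by rewrite ffunE dfwith_in. Qed.

Lemma with_choice_out q i (b : option (A i)) j :
  i != j -> with_choice q b j = q j.
Proof. by move=> ij; rewrite ffunE dfwith_out. Qed.

Lemma with_choice_overwrite q i (b c : option (A i)) :
  with_choice (with_choice q b) c = with_choice q c.
Proof.
apply/ffunP => j; have [<-|ij] := eqVneq i j; first by rewrite !with_choice_in.
by rewrite !with_choice_out.
Qed.

Lemma with_choice_id q i : with_choice q (q i) = q.
Proof.
apply/ffunP => j; have [<-|ij] := eqVneq i j; first by rewrite !with_choice_in.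
by rewrite !with_choice_out.
Qed.

Lemma choice_set_block q i (a : A i) :
  (choice_set q :&: block A i == [set Tagged A a]%SET) = (q i == Some a).
Proof.
apply/eqP/eqP => [qa|qia].
  have : Tagged A a \in choice_set q :&: block A i by rewrite qa finset.set11.
  by rewrite finset.in_setI mem_choice_set => /andP[/eqP].
apply/finset.setP => -[j b].
rewrite finset.in_setI finset.in_set1 mem_choice_set [in X in _ && X]inE/=.
have [ji|ji] := eqVneq j i; last first.
  rewrite andbF; apply/esym/negbTE.
  by apply: contraNneq ji => /(congr1 tag)/= ->.
(* Eliminating the equality of tags puts [a] and [b] in the same type, where pairs are compared by
   their second components. *)
case: i / ji a qia => a ->; rewrite andbT -tag_eqE/tag_eq/= eqxx tagged_asE.
by rewrite eq_sym; apply/eqP/eqP => [[->]|->].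
Qed.

Lemma part_factor_choice_set x q i :
  part_factor i (choice_set q) x = choice_weight x (q i).
Proof.
rewrite /part_factor; case: pickP => [a|nq].
  by rewrite choice_set_block => /eqP ->.
by case qi: (q i) => [a|//]; have := nq a; rewrite choice_set_block qi eqxx.
Qed.

Lemma part_indep_choice_set q : part_indep (choice_set q).
Proof.
apply/forallP => i; case qi: (q i) => [a|].
  by have /eqP -> : choice_set q :&: block A i == [set Tagged A a]%SET;
    rewrite ?cards1// choice_set_block qi.
suff -> : choice_set q :&: block A i = finset.set0 by rewrite cards0.
apply/finset.setP => -[j b]; rewrite !inE/=.
by apply/negP => /andP[qb /eqP ji]; move: b qb; rewrite ji qi => b /eqP.
Qed.

Lemma choice_setK : cancel choice_set set_choice.
Proof.
move=> q; apply/ffunP => i; rewrite ffunE.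
case: pickP => [a|nq]; first by rewrite mem_choice_set => /eqP.
by case qi: (q i) => [a|//]; have := nq a; rewrite mem_choice_set qi eqxx.
Qed.

(** Independence makes the [pick] unambiguous: two elements of [S] in one block coincide. *)
Lemma set_choiceK S : part_indep S -> choice_set (set_choice S) = S.
Proof.
move=> /forallP Sindep; apply/finset.setP => -[i a].
rewrite mem_choice_set ffunE.
case: pickP => [b bS|/(_ a) //]; apply/eqP/idP => [[<-]//|aS].
have /card_le1P/(_ (Tagged A b)) := Sindep i.
rewrite !inE bS eqxx => /(_ isT (Tagged A a)); rewrite !inE aS eqxx/=.
by rewrite -tag_eqE/tag_eq/= eqxx tagged_asE => /esym/eqP ->.
Qed.

Lemma part_multilinear_choices F x :
  part_multilinear F x =
  \sum_(q : choices) F (choice_set q) * \prod_(i : I) choice_weight x (q i).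
Proof.
rewrite /part_multilinear (reindex_onto choice_set set_choice)/=; last first.
  by move=> S; exact: set_choiceK.
apply: eq_big => [q|q _].
  by rewrite part_indep_choice_set choice_setK eqxx.
by congr (_ * _); apply: eq_bigr => i _; rewrite part_factor_choice_set.
Qed.

(** * Sums over choices, one block at a time *)

Lemma sum_with_choice i (b c : option (A i)) (h : choices -> R) :
  \sum_(q : choices | q i == b) h q =
  \sum_(q : choices | q i == c) h (with_choice q b).
Proof.
(* Overwriting by [b] and by [c] are mutually inverse bijections between the two fibres. *)
rewrite (reindex_onto (fun q => with_choice q b) (fun q => with_choice q c)).
  apply: eq_bigl => q; rewrite with_choice_in eqxx/= with_choice_overwrite.
  by apply/eqP/eqP => [<-|<-]; rewrite ?with_choice_in ?with_choice_id.
by move=> q /eqP <-; rewrite with_choice_overwrite with_choice_id.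
Qed.

Lemma sum_choice_weight x i : \sum_(b : option (A i)) choice_weight x b = 1.
Proof.
rewrite (bigD1 None)//= (reindex_omap Some id)//=; last by case.
by rewrite [X in _ + X](eq_bigl predT) ?subrK// => a; exact: eqxx.
Qed.

(** Each fibre of [q i] is carried onto the fibre of [None], which changes neither [g] nor the
    factors off [i]. The fibre of [None] thus stands for the choices in the other blocks. *)
Lemma sum_choices_marginal x i (g : choices -> R) :
  (forall q (b : option (A i)), g (with_choice q b) = g q) ->
  \sum_(q : choices) g q * \prod_(j : I) choice_weight x (q j) =
  \sum_(q : choices | q i == None)
    g q * \prod_(j : I | j != i) choice_weight x (q j).
Proof.
move=> gi; rewrite (partition_big (fun q : choices => q i) predT)//=.
(* The factor 1 is expanded as the total weight of block [i], so that both sides match for each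
   value [b]. *)
rewrite -[RHS]mul1r -(sum_choice_weight x i) mulr_suml.
apply: eq_bigr => b _; rewrite (sum_with_choice b None) mulr_sumr.
apply: eq_bigr => q _; rewrite (bigD1 i)//= with_choice_in gi mulrCA.
by under eq_bigr => j ji do rewrite with_choice_out 1?eq_sym//.
Qed.

(** * The partial derivative *)

Lemma choice_weight_set_coord x i (a : A i) u j (b : option (A j)) :
  j != i ->
  choice_weight (set_coord x (Tagged A a) u) b = choice_weight x b.
Proof.
move=> ji; have xE (c : A j) :
    set_coord x (Tagged A a) u (Tagged A c) = x (Tagged A c).
  by rewrite /set_coord -tag_eqE/tag_eq/= (negbTE ji).
by case: b => [b|]/=; [exact: xE | under eq_bigr do rewrite xE].
Qed.

Lemma choice_weight_set_coord_in x i (a : A i) u (b : option (A i)) :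
  choice_weight (set_coord x (Tagged A a) u) b = choice_weight x b +
    (u - x (Tagged A a)) * ((b == Some a)%:R - (b == None)%:R).
Proof.
have xE (c : A i) : set_coord x (Tagged A a) u (Tagged A c) =
    x (Tagged A c) + (u - x (Tagged A a)) * (c == a)%:R.
  rewrite /set_coord -tag_eqE/tag_eq/= eqxx tagged_asE/=.
  by have [->|_] := eqVneq c a; rewrite ?mulr1 ?subrKC// mulr0 addr0.
case: b => [b|]/=; first by rewrite xE subr0.
under eq_bigr do rewrite xE.
rewrite big_split/= -mulr_sumr sub0r mulrN1 opprD addrA; congr (_ - _).
rewrite (bigD1 a)//= eqxx big1 ?addr0 ?mulr1// => c /negbTE ->//.
Qed.

Lemma part_multilinear_set_coord F x i (a : A i) u :
  part_multilinear F (set_coord x (Tagged A a) u) = part_multilinear F x +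
  (u - x (Tagged A a)) * \sum_(q : choices | q i == None)
    (F (choice_set (with_choice q (Some a))) - F (choice_set q)) *
      \prod_(j : I | j != i) choice_weight x (q j).
Proof.
set W := fun q : choices => \prod_(j : I | j != i) choice_weight x (q j).
have Wi q (b : option (A i)) : W (with_choice q b) = W q.
  by apply: eq_bigr => j ji; rewrite with_choice_out 1?eq_sym.
(* Used below for both values where the slope is nonzero, [Some a] and [None], to bring the two sums
   to the same index set. *)
have onb (b : option (A i)) : \sum_(q : choices)
    F (choice_set q) * (q i == b)%:R * W q =
    \sum_(q : choices | q i == None) F (choice_set (with_choice q b)) * W q.
  transitivity (\sum_(q : choices | q i == b) F (choice_set q) * W q).
    rewrite [RHS]big_mkcond; apply: eq_bigr => q _.
    by case: eqP; rewrite ?mulr1 ?mulr0 ?mul0r.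
  by rewrite (sum_with_choice b None); apply: eq_bigr => q _; rewrite Wi.
(* Each product is split at block [i]: [W q] collects the factors that do not depend on [u]. *)
transitivity (\sum_(q : choices)
   (F (choice_set q) * \prod_(j : I) choice_weight x (q j) +
    (u - x (Tagged A a)) * (F (choice_set q) * (q i == Some a)%:R * W q -
                            F (choice_set q) * (q i == None)%:R * W q))).
  rewrite part_multilinear_choices; apply: eq_bigr => q _.
  rewrite (bigD1 i)//= choice_weight_set_coord_in [in RHS](bigD1 i)//= -/(W q).
  under eq_bigr => j ji do rewrite choice_weight_set_coord//.
  by rewrite -/(W q); ring.
rewrite big_split/= -part_multilinear_choices -mulr_sumr sumrB !onb -sumrB.
congr (_ + _ * _); apply: eq_bigr => q /eqP qi.
by rewrite -[in X in _ - F X * _]qi with_choice_id mulrBl.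
Qed.

Lemma partial_derivative_part_multilinear F x i (a : A i) :
  partial_derivative (part_multilinear F) (Tagged A a) x =
  \sum_(q : choices | q i == None)
    (F (choice_set (with_choice q (Some a))) - F (choice_set q)) *
      \prod_(j : I | j != i) choice_weight x (q j).
Proof.
rewrite /partial_derivative; under eq_fun do rewrite part_multilinear_set_coord.
rewrite derive1E; set D := \sum_(_ | _) _.
set c := part_multilinear F x; set k := x _.
have -> : (fun u => c + (u - k) * D) = cst c + D \*: (id - cst k : R -> R).
  by apply/funext => u; rewrite /= mulrC.
by apply: derive_val; apply: is_derive_eq; rewrite add0r subr0; exact: mulr1.
Qed.

(** Both sets overwrite [q i], so their difference ignores it, as [sum_choices_marginal] asks. The
    full product is the shape in which the law of the sampled profile appears. *)
Lemma part_multilinear_gradient F x i (a : A i) :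
  partial_derivative (part_multilinear F) (Tagged A a) x =
  \sum_(q : choices)
    (F (choice_set (with_choice q (Some a))) -
     F (choice_set (with_choice q (None : option (A i))))) *
      \prod_(j : I) choice_weight x (q j).
Proof.
rewrite partial_derivative_part_multilinear (@sum_choices_marginal x i).
  apply: eq_bigr => q /eqP qi.
  by rewrite -[in X in _ = (_ - F X) * _]qi with_choice_id.
by move=> q b; rewrite !with_choice_overwrite.
Qed.

(** * The sampled profile as a random choice *)

Definition full_choice (b : forall i, A i) : choices := [ffun i => Some (b i)].

Lemma marginal_gain_full_choice (F : {set ground A} -> R)
    (b : forall i, A i) i (a : A i) :
  marginal_gain F b i a =
  F (choice_set (with_choice (full_choice b) (Some a))) -
  F (choice_set (with_choice (full_choice b) (None : option (A i)))).
Proof.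
have memp j (c : A j) : (Tagged A c \in profile_set b) = (c == b j).
  apply/imsetP/eqP => [[k _ kc]|->]; last by exists j.
  have jk : j = k := congr1 tag kc.
  by case: k / jk kc => /eqP; rewrite -tag_eqE/tag_eq/= eqxx tagged_asE => /eqP.
have tagi (c c' : A i) : (Tagged A c == Tagged A c') = (c == c').
  by rewrite -tag_eqE/tag_eq/= eqxx tagged_asE.
have tagj j (c : A j) (c' : A i) :
    j != i -> (Tagged A c == Tagged A c') = false.
  by move=> ji; rewrite -tag_eqE/tag_eq/= (negbTE ji).
rewrite /marginal_gain.
have -> : (profile_set b :\ Tagged A (b i))%SET =
    choice_set (with_choice (full_choice b) (None : option (A i))).
  apply/finset.setP => -[j c]; rewrite in_setD1 memp mem_choice_set.
  have [ji|ji] := eqVneq j i; last first.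
    by rewrite tagj// with_choice_out 1?eq_sym// ffunE eq_sym.
  move: c; rewrite ji => c.
  by rewrite with_choice_in tagi; case: eqP.
congr (F _ - _).
apply/finset.setP => -[j c].
rewrite finset.in_setU finset.in_set1 !mem_choice_set.
have [ji|ji] := eqVneq j i; last first.
  by rewrite tagj// orbF !with_choice_out// eq_sym.
by move: c; rewrite ji => c; rewrite !with_choice_in tagi/= eq_sym.
Qed.

(** This is the form to which independence applies. The event of index [i] is empty when [q i] is
    [None]. *)
Lemma full_choice_preimage (T : Type) (act : forall i, T -> A i)
    (q : choices) :
  ((fun w => full_choice (fun i => act i w)) @^-1` [set q] =
   \bigcap_i (act i @^-1` [set b | Some b = q i]))%classic.
Proof.
apply/seteqP; split => [w <- i _|w wq]; first by rewrite /= ffunE.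
by apply/ffunP => i; rewrite ffunE; exact: wq.
Qed.

Lemma full_choice_law (d : measure_display) (T : measurableType d)
    (P : probability T R) (act : forall i, T -> A i) (x : ground A -> R)
    (q : choices) :
  (forall i, \sum_(a : A i) x (Tagged A a) = 1) ->
  actions_law P act (fun i a => x (Tagged A a)) ->
  actions_independent P act ->
  P ((fun w => full_choice (fun i => act i w)) @^-1` [set q])%classic =
  (\prod_(i : I) choice_weight x (q i))%:E.
Proof.
move=> x1 law ind; rewrite full_choice_preimage ind -prodEFin.
apply: eq_bigr => i _.
case: (q i) => [b|]/=.
  rewrite -law; congr (P (_ @^-1` _)%classic).
  by apply/seteqP; split => [c []|c ->].
(* For [None], the weight is 1 - 1 = 0 and the event is empty. *)
rewrite x1 subrr (_ : (_ @^-1` _)%classic = classical_sets.set0) ?measure0//.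
by apply/seteqP; split.
Qed.

Theorem expectation_marginal_gain (d : measure_display) (T : measurableType d)
    (P : probability T R) (act : forall i, T -> A i) (x : ground A -> R)
    (F : {set ground A} -> R) i (a : A i) :
  (forall i, \sum_(a : A i) x (Tagged A a) = 1) ->
  actions_measurable act ->
  actions_law P act (fun i a => x (Tagged A a)) ->
  actions_independent P act ->
  ('E_P[fun w => marginal_gain F (fun j => act j w) i a])%E =
  (partial_derivative (part_multilinear F) (Tagged A a) x)%:E.
Proof.
move=> x1 mact law ind.
(* The estimator is this function of the sampled choice, and the gradient is its weighted sum over
   all choices. *)
pose g (q : choices) := F (choice_set (with_choice q (Some a))) -
  F (choice_set (with_choice q (None : option (A i)))).
have -> : (fun w => marginal_gain F (fun j => act j w) i a) =
    g \o (fun w => full_choice (fun j => act j w)).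
  by apply/funext => w; exact: marginal_gain_full_choice.
rewrite expectation_fin => [|q].
  rewrite part_multilinear_gradient -sumEFin; apply: eq_bigr => q _.
  by rewrite EFinM (full_choice_law q x1 law ind).
rewrite full_choice_preimage.
by apply: fin_bigcap_measurable => // j _; exact: mact.
Qed.

End OptionProfiles.

Unset Implicit Arguments.

Theorem mainTheorem5 (R : realType) (State : Type) (Agent : choiceType)
  (N : nat -> {fset Agent})
  (Act Obs : Agent -> finType)
  (Act_nonempty : forall i : Agent, (0 < #|Act i|)%N)
  (obs : forall i : Agent, nat -> State -> Obs i)
  (F : forall t : nat, State -> {set ground (active Act (N t))} -> R)
  (t : nat) (s : State)
  (F_nonneg : set_fun_nonneg (F t s))
  (F_normalized : set_fun_normalized (F t s))
  (F_monotone : set_fun_monotone (F t s))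
  (F_submodular : set_fun_submodular (F t s))
  (pol : forall i : N t, Obs (val i) -> Act (val i) -> R)
  (pol_pmf : forall (i : N t) (o : Obs (val i)), is_pmf (pol i o))
  (d : measure_display) (T : measurableType d) (P : probability T R)
  (act : forall i : N t, T -> active Act (N t) i)
  (act_measurable : actions_measurable act)
  (act_law : actions_law P act (fun i => pol i (obs (val i) t s)))
  (act_independent : actions_independent P act)
  (i : N t) (a : active Act (N t) i) :
  let xpi : ground (active Act (N t)) -> R :=
    fun e => pol (tag e) (obs (val (tag e)) t s) (tagged e) in
  ('E_P[fun w : T => marginal_gain (F t s) (fun j => act j w) i a])%E
  = (partial_derivative (part_multilinear (F t s))
       (Tagged (active Act (N t)) a) xpi)%:E.
Proof.
move=> xpi; apply: expectation_marginal_gain => // j.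
by have [] := pol_pmf j (obs (val j) t s).
Qed.
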